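(* Let $G=G_1\cup G_2$ be a connected graph, where $G_1,G_2$ are connected, edge-disjoint subgraphs with $G_1\cap G_2=\{p,q,s\}$ for three distinct vertices $p,q,s$ of $G$. Then $$t(G)=t(G_1)\,t(G_{2,pqs})+t(G_2)\,t(G_{1,pqs})+\frac12\Big[a_1(-a_2+b_2+c_2)+b_1(a_2-b_2+c_2)+c_1(a_2+b_2-c_2)\Big],$$ where $a_i=t(G_{i,ps})$, $b_i=t(G_{i,pq})$, $c_i=t(G_{i,qs})$ for $i\in\{1,2\}$. In particular, if $G_2$ is a copy of $G_1$ glued along the same three vertices $p,q,s$, then $t(G)=4\,t(G_1)\,t(G_{1,pqs})$.
   Context: Graphs are finite and may have multiple edges and loops; $t(H)$ is the number of spanning trees of $H$ (a one-vertex graph has $t=1$). $G_{i,xy}$ is obtained from $G_i$ by identifying vertices $x$ and $y$; $G_{i,pqs}$ is obtained from $G_i$ by identifying $p,q,s$ into a single vertex. *)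

(* Defs.v *)
(* Multigraphs (loops and parallel edges allowed) living
   inside an ambient vertex type V and edge type E; each edge e has two
   endpoints src e, tgt e (orientation irrelevant). A graph is given by a
   vertex set VS : {set V} and an edge set ES : {set E}. *)
From mathcomp Require Import all_boot all_order all_algebra.
Set Implicit Arguments. Unset Strict Implicit. Unset Printing Implicit Defensive.

Section Graphs.
Variables (V E : finType) (src tgt : E -> V).

Definition adj (F : {set E}) : rel V := fun x y =>
  [exists e in F, ((src e == x) && (tgt e == y)) || ((src e == y) && (tgt e == x))].

Definition wf_graph (VS : {set V}) (ES : {set E}) : bool :=
  [forall e in ES, (src e \in VS) && (tgt e \in VS)].

Definition connected_graph (VS : {set V}) (ES : {set E}) : bool :=
  [forall x in VS, forall y in VS, connect (adj ES) x y].

(* F is a spanning tree of (VS, ES): F is a set of edges of the graph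
   connecting all vertices, and acyclic (every edge of F is a bridge of F;
   in particular F contains no loop and no pair of parallel edges). *)
Definition spanning_tree (VS : {set V}) (ES : {set E}) (F : {set E}) : bool :=
  [&& F \subset ES,
      [forall x in VS, forall y in VS, connect (adj F) x y] &
      [forall e in F, ~~ connect (adj (F :\ e)) (src e) (tgt e)]].

Definition ntrees (VS : {set V}) (ES : {set E}) : nat :=
  #|[set F : {set E} | spanning_tree VS ES F]|.
End Graphs.

(* Identification of vertices: the quotient graph obtained by applying a
   vertex map f (collapsing the identified vertices to one representative)
   to the vertex set and to the endpoints of every edge. *)
Definition ntrees_quot (V E : finType) (src tgt : E -> V) (f : V -> V)
  (VS : {set V}) (ES : {set E}) : nat :=
  ntrees (f \o src) (f \o tgt) (f @: VS) ES.

Definition ident2 (V : eqType) (x y : V) (v : V) : V := if v == y then x else v.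
Definition ident3 (V : eqType) (p q s : V) (v : V) : V :=
  if (v == q) || (v == s) then p else v.

(* Main.v *)
(* By deletion-contraction of an edge at the root p, the number of spanning trees
   is the determinant of the Laplacian reduced at p.  Eliminating the vertices
   other than p, q, s by a Schur complement turns each G_i into its response
   matrix S_i on {q, s}: with T_i = t(G_{i,pqs}) the determinant of the
   eliminated block, nonzero since G_i is connected, one has
     t(G_i) = T_i det S_i,  a_i = T_i S_i(q,q),  b_i = T_i S_i(s,s),
     c_i = T_i (S_i(q,q) + 2 S_i(q,s) + S_i(s,s)).
   The eliminated block of G is block diagonal and response matrices add, so
   t(G) = T_1 T_2 det (S_1 + S_2), and the formula is the expansion of this
   2 x 2 determinant.  For a copy, S_1 = S_2 and det (2 S_1) = 4 det S_1. *)
Require Import Defs.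
From mathcomp Require Import all_boot all_order all_algebra.
From mathcomp Require Import ring.
Set Implicit Arguments.
Unset Strict Implicit.
Unset Printing Implicit Defensive.
Import GRing.Theory Num.Theory.
Local Open Scope ring_scope.

(** * Deletion and contraction *)

Lemma adj_sym (V E : finType) (src tgt : E -> V) (F : {set E}) :
  symmetric (adj src tgt F).
Proof. by move=> x y; apply: eq_existsb => e; rewrite orbC. Qed.

Lemma connect_adj_sym (V E : finType) (src tgt : E -> V) (F : {set E}) :
  connect_sym (adj src tgt F).
Proof. exact/sym_connect_sym/adj_sym. Qed.

Lemma connect_edge (V E : finType) (src tgt : E -> V) (F : {set E}) (e : E) :
  e \in F -> connect (adj src tgt F) (src e) (tgt e).
Proof.
by move=> Fe; apply/connect1/existsP; exists e; rewrite Fe !eqxx.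
Qed.

(** Induction along the path: each step uses an edge of [F] in one of its two directions, and
    symmetry of [connect r] absorbs the direction. It transports connectivity along a contraction,
    and between edge sets when [h] is [id]. *)
Lemma connect_adj_map (V W E : finType) (src tgt : E -> V) (F : {set E})
    (r : rel W) (h : V -> W) (x y : V) :
    connect_sym r ->
    {in F, forall e, connect r (h (src e)) (h (tgt e))} ->
  connect (adj src tgt F) x y -> connect r (h x) (h y).
Proof.
move=> r_sym rF /connectP[w]; elim: w x => [|z w IHw] x /=.
  by move=> _ ->; exact: connect0.
move=> /andP[/existsP[e /andP[Fe xz]] wz] /(IHw _ wz).
apply: connect_trans.
by case/orP: xz => /andP[/eqP <- /eqP <-]; last rewrite r_sym; exact: rF.
Qed.

(** Take a path without repeated vertices: after its first step it never returns to [x], hence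
    cannot reuse [e], which is incident to [x]. *)
Lemma connect_first_edge (V E : finType) (src tgt : E -> V) (F : {set E})
    (x y : V) :
    x != y -> connect (adj src tgt F) x y ->
  exists e, exists2 z,
    [/\ e \in F, z != x & (src e, tgt e) = (x, z) \/ (src e, tgt e) = (z, x)] &
    connect (adj src tgt (F :\ e)) z y.
Proof.
move=> neq_xy /connectP[w0 w0P yE]; rewrite {}yE in neq_xy *.
move: neq_xy; case/shortenP: w0P => w; case: w => [|z w] /=.
  by rewrite eqxx.
move=> /andP[/existsP[e /andP[Fe xz]] wP] /andP[xw uw] _ _.
have xe : (src e, tgt e) = (x, z) \/ (src e, tgt e) = (z, x).
  by case/orP: xz => /andP[/eqP -> /eqP ->]; [left | right].
exists e, z; first by split=> //; apply: contraNneq xw => <-; rewrite mem_head.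
apply/connectP; exists w => //.
have xNzw : all (fun v => v != x) (z :: w).
  by apply/allP => v vzw; apply: contraNneq xw => <-.
have eNF' a b : a != x -> b != x ->
    adj src tgt F a b -> adj src tgt (F :\ e) a b.
  move=> aNx bNx /existsP[e' /andP[Fe' e'ab]]; apply/existsP; exists e'.
  rewrite !inE Fe' e'ab !andbT; apply: contraTneq e'ab => ->.
  by case: xe => -[-> ->]; rewrite !(eq_sym x) (negPf aNx) (negPf bNx) ?andbF.
elim: w z wP {uw xw xz xe Fe} xNzw => //= v w IHw z.
move=> /andP[zv wP] /and3P[zNx vNx xw].
by rewrite IHw /= ?vNx // eNF'.
Qed.

Section Contraction.
Variables (V E : finType) (src tgt : E -> V) (e : E) (r y : V).
Hypothesis e_ry : (src e, tgt e) = (r, y) \/ (src e, tgt e) = (y, r).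
Let f := ident2 r y.

(** The edge [e] joins every vertex to its image under [f], so a path in the quotient lifts once [e]
    is available; conversely [f] sends both ends of [e] to the same vertex. *)
Lemma connect_contract (F : {set E}) (u v : V) :
  connect (adj (f \o src) (f \o tgt) F) (f u) (f v)
  = connect (adj src tgt (e |: F)) u v.
Proof.
have fr : f r = f y by rewrite /f /ident2 eqxx; case: eqP.
have csym := connect_adj_sym src tgt (e |: F).
have f_conn w : connect (adj src tgt (e |: F)) w (f w).
  rewrite /f /ident2; case: eqP => [->|_]; last exact: connect0.
  have := connect_edge src tgt (setU11 e F).
  by case: e_ry => -[-> ->]; rewrite // csym.
apply/idP/idP => [fuv|].
  apply: connect_trans (f_conn u) _; rewrite csym.
  apply: connect_trans (f_conn v) _; rewrite csym.
  apply: (connect_adj_map (h := id) csym _ fuv) => e' Fe' /=.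
  rewrite csym; apply: connect_trans (f_conn _).
  by rewrite csym; apply: connect_trans (f_conn _); apply/connect_edge/setU1r.
apply: connect_adj_map; first exact: connect_adj_sym.
move=> e' /setU1P[-> | Fe']; last exact: (connect_edge (f \o src) (f \o tgt)).
by case: e_ry => -[-> ->]; rewrite fr connect0.
Qed.

Hypothesis neq_ry : r != y.

(** Connectedness transfers by [connect_contract], and so does the bridge condition at edges of [F].
    What remains is that [e] is itself a bridge of [e |: F]: otherwise a path in [F] between its
    ends would become a cycle in the quotient. *)
Lemma spanning_tree_contract (VS : {set V}) (ES F : {set E}) :
    e \in ES -> e \notin F ->
  spanning_tree src tgt VS ES (e |: F)
  = spanning_tree (f \o src) (f \o tgt) (f @: VS) (ES :\ e) F.
Proof.
move=> ESe FNe; rewrite /spanning_tree subUset sub1set ESe subsetD1 FNe andbT.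
congr [&& _, _ & _].
  apply/forall_inP/forall_inP => conn.
    move=> _ /imsetP[u Vu ->]; apply/forall_inP => _ /imsetP[v Vv ->].
    by rewrite connect_contract; move/forall_inP: (conn u Vu); apply.
  move=> u Vu; apply/forall_inP => v Vv; rewrite -connect_contract.
  by move/forall_inP: (conn _ (imset_f f Vu)); apply; apply: imset_f.
have eFD e' : e' \in F -> (e |: F) :\ e' = e |: (F :\ e').
  move=> Fe'; rewrite setDUl; congr (_ :|: _); apply/setDidPl.
  by rewrite disjoints1 inE; apply: contraNneq FNe => ->.
apply/forall_inP/forall_inP => acyc e' Fe'.
  by rewrite /= connect_contract -eFD //; apply/acyc/setU1r.
case/setU1P: Fe' => [->{e'} | Fe']; last first.
  by rewrite eFD // -connect_contract; apply: acyc.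
rewrite setU1K //; apply/negP => conn_e.
have {conn_e}: connect (adj src tgt F) r y.
  by case: e_ry conn_e => -[-> ->] //; rewrite connect_adj_sym.
(* The other end z of the first edge e' of a path from r to y in F reaches y
   without e', so e' closes a cycle once y is merged into r. *)
case/connect_first_edge => // e' [z [Fe' _ e'rz] zy].
apply/negP: (acyc e' Fe'); rewrite negbK.
rewrite /= connect_contract.
(* Since [e] merges [r] and [y], it suffices to join [y] to [z], which [zy] does backwards. *)
have rz : connect (adj src tgt (e |: (F :\ e'))) r z.
  rewrite -connect_contract (_ : f r = f y); last first.
    by rewrite /f /ident2 eqxx; case: eqP.
  rewrite connect_contract connect_adj_sym.
  apply: (connect_adj_map (h := id) (connect_adj_sym _ _ _) _ zy) => e'' Fe''.
  exact/connect_edge/setU1r.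
by case: e'rz => -[-> ->] //; rewrite connect_adj_sym.
Qed.

(** Trees avoiding [e] are those of the graph with [e] deleted; trees containing [e] correspond, by
    removing it, to those of the contraction. *)
Lemma ntrees_contract (VS : {set V}) (ES : {set E}) : e \in ES ->
  ntrees src tgt VS ES = (ntrees src tgt VS (ES :\ e)
    + ntrees_quot src tgt f VS (ES :\ e))%N.
Proof.
move=> ESe; rewrite /ntrees_quot /ntrees.
rewrite -(cardsID [set F : {set E} | e \in F]) addnC.
congr (_ + _)%N.
  apply: eq_card => F; rewrite !inE /spanning_tree subsetD1.
  by case: (e \in F); rewrite /= ?andbF ?andbT.
rewrite -[RHS](card_in_imset (f := fun F => e |: F)).
  apply: eq_card => F; rewrite !inE. apply/andP/imsetP => [[stF Fe]|[F']].
    exists (F :\ e); last by rewrite setD1K.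
    by rewrite inE -spanning_tree_contract ?setD11 // setD1K.
  rewrite inE => stF' ->; rewrite setU11.
  rewrite spanning_tree_contract //; case/and3P: stF'; rewrite subsetD1.
  by case/andP.
move=> F1 F2; rewrite !inE => /and3P[+ _ _] /and3P[+ _ _].
rewrite !subsetD1 => /andP[_ F1e] /andP[_ F2e] eqF.
by rewrite -(setU1K F1e) eqF setU1K.
Qed.
End Contraction.

(** * The matrix-tree theorem *)

Lemma imset_ident2 (V : finType) (x y : V) (VS : {set V}) :
  x != y -> x \in VS -> ident2 x y @: VS = VS :\ y.
Proof.
move=> neq_xy Vx; apply/setP => u; rewrite !inE; apply/imsetP/andP.
  by case=> v Vv ->; rewrite /ident2; case: (eqVneq v y) => // ->.
by case=> uNy Vu; exists u => //; rewrite /ident2 (negPf uNy).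
Qed.

Lemma ident2_eq (V : eqType) (x y u v : V) :
  u != x -> u != y -> (ident2 x y v == u) = (v == u).
Proof.
rewrite /ident2 => uNx uNy; case: (eqVneq v y) => // ->.
by rewrite eq_sym (negPf uNx) eq_sym (negPf uNy).
Qed.

Section Laplacian.
Variables (R : fieldType) (V E : finType).
Implicit Types (src tgt : E -> V) (ES : {set E}).

(** The Laplacian as a sum of squares of signed incidence vectors: loops contribute zero, and
    reversing an edge changes nothing. As a function on the ambient vertices, it serves a graph and
    its quotients alike. *)
Definition lap src tgt ES (u v : V) : R :=
  \sum_(e in ES) ((src e == u)%:R - (tgt e == u)%:R)
               * ((src e == v)%:R - (tgt e == v)%:R).

Definition kermat (L : V -> V -> R) m n (g : 'I_m -> V) (h : 'I_n -> V) :
  'M[R]_(m, n) := \matrix_(i, j) L (g i) (h j).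

Lemma lap_sym src tgt ES u v : lap src tgt ES u v = lap src tgt ES v u.
Proof. by apply: eq_bigr => e _; rewrite mulrC. Qed.

Lemma lap_ident2 src tgt ES (x y u v : V) :
    u != x -> u != y -> v != x -> v != y ->
  lap (ident2 x y \o src) (ident2 x y \o tgt) ES u v = lap src tgt ES u v.
Proof. by move=> *; apply: eq_bigr => e _; rewrite /= !ident2_eq. Qed.

Lemma codom_lift n (g : 'I_n.+1 -> V) (i0 : 'I_n.+1) : injective g ->
  codom (g \o lift i0) =i [predD1 codom g & g i0].
Proof.
move=> g_inj u; rewrite !inE; apply/codomP/andP => [[j ->]|[uNi /codomP[j uE]]].
  by rewrite /= inj_eq // eq_sym neq_lift codom_f.
case: (unliftP i0 j) uE => [k ->|->] uE; first by exists k.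
by rewrite uE eqxx in uNi.
Qed.

(** Induction on the number of edges, by deletion and contraction of a non-loop edge at the root.
    Without such an edge, both sides are 1 if [r] is the only vertex and 0 otherwise. *)
Lemma matrix_tree src tgt (VS : {set V}) ES (r : V) n (g : 'I_n -> V) :
    wf_graph src tgt VS ES -> r \in VS -> injective g -> codom g =i VS :\ r ->
  \det (kermat (lap src tgt ES) g g) = (ntrees src tgt VS ES)%:R.
Proof.
have [k] := ubnP #|ES|.
elim: k => // k IHk in src tgt VS ES n g *; rewrite ltnS => leESk wf Vr g_inj g_im.
have gNr i : g i != r.
  by have := codom_f g i; rewrite g_im !inE => /andP[].
case: (boolP [exists e in ES, (src e == r) != (tgt e == r)]); last first.
  rewrite negb_exists_in => /forall_inP noEr.
  case: n => [|n] in g g_inj g_im gNr *.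
    (* Here [r] is the only vertex, all edges are loops, and the empty set is the unique spanning
       tree. *)
    have VSr u : u \in VS -> u = r.
      move=> Vu; have [//|uNr] := eqVneq u r.
      by have /codomP[[]] : u \in codom g by rewrite g_im !inE uNr.
    rewrite det_mx00 /ntrees (_ : [set F | _] = [set set0]) ?cards1 //.
    apply/setP => F; rewrite !inE; apply/idP/eqP => [/and3P[sFE _ acyc]|->].
      apply/setP => e; rewrite inE; apply/negP => Fe.
      have := forall_inP acyc e Fe.
      have /andP[/VSr-> /VSr->] := forall_inP wf e (subsetP sFE e Fe).
      by rewrite connect0.
    apply/and3P; split; first exact: sub0set.
      apply/forall_inP => u /VSr->; apply/forall_inP => v /VSr->.
      exact: connect0.
    by apply/forall_inP => e; rewrite inE.
  (* No edge joins r to the rest: the reduced Laplacian kills constants. *)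
  have -> : \det (kermat (lap src tgt ES) g g) = 0.
    apply/eqP/det0P; exists (const_mx 1).
      by apply/eqP => /matrixP/(_ 0 0); rewrite !mxE; apply/eqP/oner_neq0.
    apply/matrixP => i j; rewrite !mxE.
    under eq_bigr => l _ do rewrite !mxE mul1r.
    rewrite exchange_big big1 // => e ESe /=; rewrite -mulr_suml.
    have sumE (u : V) : u \in VS ->
        \sum_(l < n.+1) (u == g l)%:R = (u != r)%:R :> R.
      move=> Vu; case: (eqVneq u r) => [->|uNr].
        by rewrite big1 // => l _; rewrite eq_sym (negPf (gNr l)).
      have /codomP[l0 ->] : u \in codom g by rewrite g_im !inE uNr.
      rewrite (bigD1 l0) //= eqxx big1 ?addr0 // => l lNl0.
      by rewrite inj_eq // eq_sym (negPf lNl0).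
    have /andP[Vs Vt] := forall_inP wf e ESe.
    rewrite sumrB !sumE //.
    by have /negPn/eqP-> := noEr e ESe; rewrite subrr mul0r.
  (* No spanning tree exists either: a path from [r] to [g 0] would start with a non-loop edge at
     [r]. *)
  rewrite /ntrees (_ : [set F | _] = set0) ?cards0 //.
  apply/setP => F; rewrite !inE; apply/negP => /and3P[sFE conn _].
  have Vg : g 0 \in VS by have := codom_f g 0; rewrite g_im !inE => /andP[].
  have := forall_inP (forall_inP conn r Vr) _ Vg.
  case/connect_first_edge; first by rewrite eq_sym.
  move=> e [z [Fe zNr erz] _]; apply/negP: (noEr e (subsetP sFE e Fe)).
  by rewrite negbK; case: erz => -[-> ->]; rewrite eqxx (negPf zNr).
case/existsP => e /andP[ESe er].
have [y yNr e_ry] : exists2 y, y != r &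
    (src e, tgt e) = (r, y) \/ (src e, tgt e) = (y, r).
  case: (eqVneq (src e) r) er => [->|sNr] er.
    by exists (tgt e); [case: (tgt e == r) er | left].
  by exists (src e) => //; right; case: (eqVneq (tgt e) r) er => // ->.
have Vy : y \in VS.
  by have /andP[] := forall_inP wf e ESe; case: e_ry => -[-> ->].
have [i0 yE] : exists i0, y = g i0.
  by apply/codomP; rewrite g_im !inE yNr.
have leESek : (#|ES :\ e| < k)%N by rewrite (cardsD1 e) ESe in leESk.
case: n => [|n] in g g_inj g_im gNr i0 yE *; first by case: i0 {yE}.
(* The root has no row or column, so [e] contributes only a 1 at the diagonal entry of [y]. *)
have lapD i j : lap src tgt ES (g i) (g j) =
    lap src tgt (ES :\ e) (g i) (g j) + ((i == i0) && (j == i0))%:R.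
  rewrite /lap (big_setD1 e) //= addrC; congr (_ + _).
  rewrite (_ : (i == i0) = (y == g i)); last by rewrite yE inj_eq // eq_sym.
  rewrite (_ : (j == i0) = (y == g j)); last by rewrite yE inj_eq // eq_sym.
  have rNg l : (r == g l) = false by rewrite eq_sym (negPf (gNr l)).
  by case: e_ry => -[-> ->]; rewrite !rNg; do 2!case: (y == _) => /=; ring.
have wf' : wf_graph src tgt VS (ES :\ e).
  by apply/forall_inP => e'; rewrite !inE => /andP[_ /(forall_inP wf)].
rewrite (ntrees_contract e_ry) 1?eq_sym // natrD -(IHk _ _ _ _ _ g) //.
pose f := ident2 r y.
have fr : f r = r by rewrite /f /ident2 eq_sym (negPf yNr).
have fVS : f @: VS = VS :\ y by rewrite imset_ident2 // eq_sym.
(* The contraction keeps the root [r] and loses [y], so its non-root vertices are those of [g]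
   without the index [i0]. *)
rewrite /ntrees_quot -(IHk _ _ _ _ _ (g \o lift i0)) //; first last.
- by move=> u; rewrite codom_lift // !inE g_im fVS !inE -yE; case: eqP; case: eqP.
- exact: inj_comp g_inj lift_inj.
- by rewrite -/f fVS !inE eq_sym yNr.
- apply/forall_inP => e' /(forall_inP wf')/andP[Vs Vt].
  by rewrite /= !imset_f.
have liftN l : (lift i0 l == i0) = false by rewrite eq_sym (negPf (neq_lift _ _)).
set B := kermat (lap src tgt (ES :\ e)) g g.
set A := kermat (lap src tgt ES) g g.
(* By [lapD], row [i0] of [A] is that of [B] plus a unit vector. Linearity in this row gives the
   deletion term [\det B], and [\det C] is the minor of [A] without row and column [i0], the
   contraction term. *)
pose C := \matrix_(i, j) (if i == i0 then (j == i0)%:R else A i j).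
have -> : \det A = 1 * \det B + 1 * \det C.
  apply: (determinant_multilinear (i0 := i0)); apply/matrixP => i j.
  - by rewrite !mxE lapD !eqxx /= !mul1r.
  - by rewrite !mxE lapD liftN addr0.
  - by rewrite !mxE liftN.
rewrite !mul1r; congr (_ + _); rewrite (expand_det_row _ i0) (bigD1 i0) //=.
rewrite big1 => [|j jNi]; last by rewrite !mxE eqxx (negPf jNi) mul0r.
rewrite !mxE !eqxx mul1r addr0 /cofactor addnn -signr_odd odd_double mul1r.
congr (\det _); apply/matrixP => i j; rewrite !mxE liftN.
rewrite lap_ident2 ?gNr // ?yE ?(inj_eq g_inj) ?liftN // lapD.
by rewrite liftN addr0.
Qed.

(** * Laplacians of unions and quotients *)

Lemma lap0l src tgt (VS : {set V}) ES u v :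
  wf_graph src tgt VS ES -> u \notin VS -> lap src tgt ES u v = 0.
Proof.
move=> wf VNu; rewrite /lap big1 // => e /(forall_inP wf)/andP[Vs Vt].
have sNu w : w \in VS -> (w == u) = false.
  by move=> Vw; apply: contraNF VNu => /eqP <-.
by rewrite !sNu // subrr mul0r.
Qed.

Lemma lapU src tgt ES1 ES2 u v : [disjoint ES1 & ES2] ->
  lap src tgt (ES1 :|: ES2) u v = lap src tgt ES1 u v + lap src tgt ES2 u v.
Proof. by move=> dis; rewrite /lap -bigU //; apply: eq_bigl => e; rewrite !inE. Qed.

Lemma lap_ident3 src tgt ES (p q s u v : V) :
    u \notin [set p; q; s] -> v \notin [set p; q; s] ->
  lap (ident3 p q s \o src) (ident3 p q s \o tgt) ES u v = lap src tgt ES u v.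
Proof.
have eq3 w w' : w \notin [set p; q; s] -> (ident3 p q s w' == w) = (w' == w).
  rewrite !inE !negb_or /ident3 => /andP[/andP[wNp wNq] wNs].
  case: (eqVneq w' q) => [->|_].
    by rewrite !(eq_sym _ w) (negPf wNp) (negPf wNq).
  by case: (eqVneq w' s) => // ->; rewrite !(eq_sym _ w) (negPf wNp) (negPf wNs).
by move=> u3 v3; apply: eq_bigr => e _; rewrite /= !eq3.
Qed.

(** Merging [s] into [q] adds their incidence vectors, so the Laplacian rows and columns of [q] and
    [s] add up as well. *)
Lemma ident2_eql (q s w : V) : q != s ->
  (ident2 q s w == q)%:R = (w == q)%:R + (w == s)%:R :> R.
Proof.
move=> qNs; rewrite /ident2; case: (eqVneq w s) => [->|_]; last by rewrite addr0.
by rewrite eqxx eq_sym (negPf qNs) add0r.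
Qed.

Lemma lap_ident2l src tgt ES (q s v : V) : v != q -> v != s ->  q != s ->
  lap (ident2 q s \o src) (ident2 q s \o tgt) ES q v
  = lap src tgt ES q v + lap src tgt ES s v.
Proof.
move=> vNq vNs qNs; rewrite -big_split; apply: eq_bigr => e _.
rewrite /= !(ident2_eq _ vNq vNs) -mulrDl; congr (_ * _).
by rewrite !ident2_eql //; ring.
Qed.

Lemma lap_ident2ll src tgt ES (q s : V) : q != s ->
  lap (ident2 q s \o src) (ident2 q s \o tgt) ES q q
  = lap src tgt ES q q + lap src tgt ES q s *+ 2 + lap src tgt ES s s.
Proof.
move=> qNs; rewrite -sumrMnl -!big_split; apply: eq_bigr => e _ /=.
by rewrite !ident2_eql //; ring.
Qed.
End Laplacian.

(** Energy argument: a kernel vector, extended by zero, is a potential whose squared differences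
    along edges sum to 0. Over an ordered field it is constant along edges, hence by connectedness
    equal to its value 0 at [r]. Since [g] may list only some non-root vertices, this covers the
    inner blocks. *)
Lemma lap_unitmx (R : realFieldType) (V E : finType) (src tgt : E -> V)
    (VS : {set V}) (ES : {set E}) (r : V) n (g : 'I_n -> V) :
    connected_graph src tgt VS ES -> r \in VS -> injective g ->
    codom g \subset VS :\ r ->
  kermat (lap R src tgt ES) g g \in unitmx.
Proof.
move=> conn Vr g_inj /subsetP g_im.
rewrite unitmxE unitfE; apply/det0P => -[v vn0 vA0].
(* The extension of [v] by zero outside the image of [g]. *)
pose x u := \sum_i v 0 i * (u == g i)%:R.
have xE e : x (src e) - x (tgt e)
    = \sum_i v 0 i * ((src e == g i)%:R - (tgt e == g i)%:R).
  by rewrite -sumrB; apply: eq_bigr => i _; rewrite mulrBr.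
have energy0 : \sum_(e in ES) (x (src e) - x (tgt e)) ^+ 2 = 0.
  transitivity ((v *m kermat (lap R src tgt ES) g g *m v^T) 0 0); last first.
    by rewrite vA0 mul0mx mxE.
  rewrite mxE; under [RHS]eq_bigr => j _.
    rewrite !mxE mulr_suml.
    under eq_bigr => i _ do rewrite mxE mulr_sumr mulr_suml.
    over.
  under [RHS]eq_bigr => j _ do rewrite exchange_big.
  rewrite exchange_big; apply: eq_bigr => e _ /=.
  rewrite expr2 {2}xE mulr_sumr; apply: eq_bigr => j _.
  rewrite xE mulr_suml; apply: eq_bigr => i _; ring.
have x_edge : {in ES, forall e, x (src e) = x (tgt e)}.
  move=> e ESe; apply/eqP; rewrite -subr_eq0 -sqrf_eq0.
  have /psumr_eq0P-> // : forall e, e \in ES -> 0 <= (x (src e) - x (tgt e)) ^+ 2.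
  by move=> *; apply: sqr_ge0.
have xr : x r = 0.
  rewrite /x big1 // => i _; have := g_im _ (codom_f g i).
  by rewrite !inE eq_sym => /andP[/negPf-> _]; rewrite mulr0.
case/eqP: vn0; apply/matrixP => i0 i; rewrite ord1 mxE.
have Vgi : g i \in VS by have := g_im _ (codom_f g i); rewrite !inE => /andP[].
have x_conn := forall_inP (forall_inP conn _ Vgi) r Vr.
have xg0 : x (g i) = 0.
  have x_closed : closed (adj src tgt ES) [pred u | x u == 0].
    move=> a b /existsP[e /andP[/x_edge xe]] /orP[]/andP[/eqP <- /eqP <-];
      by rewrite !inE xe.
  by have := closed_connect x_closed x_conn; rewrite !inE xr eqxx => /eqP.
move: xg0; rewrite /x (bigD1 i) //= eqxx mulr1 big1 ?addr0 // => j jNi.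
by rewrite (inj_eq g_inj) eq_sym (negPf jNi) mulr0.
Qed.

(** * Schur complements *)

Section Schur.
Variables (R : fieldType) (V : finType).
Implicit Types (L : V -> V -> R) (u v : V).

Definition glue m n (us : 'I_m -> V) (g : 'I_n -> V) (i : 'I_(m + n)) : V :=
  match split i with inl j => us j | inr j => g j end.

Lemma kermat_glue L m n m' n' (us : 'I_m -> V) (g : 'I_n -> V)
    (ws : 'I_m' -> V) (h : 'I_n' -> V) :
  kermat L (glue us g) (glue ws h)
  = block_mx (kermat L us ws) (kermat L us h) (kermat L g ws) (kermat L g h).
Proof.
apply/matrixP => i j; rewrite !mxE /glue.
by do 2!(case: split => ?; rewrite !mxE).
Qed.

Lemma glue_inj m n (us : 'I_m -> V) (g : 'I_n -> V) :
    injective us -> injective g -> (forall i j, us i != g j) ->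
  injective (glue us g).
Proof.
move=> us_inj g_inj usNg i j; rewrite /glue.
case: split_ordP => a ->; case: split_ordP => b -> ab.
- by rewrite (us_inj _ _ ab).
- by have := usNg a b; rewrite ab eqxx.
- by have := usNg b a; rewrite ab eqxx.
- by rewrite (g_inj _ _ ab).
Qed.

Lemma codom_glue m n (us : 'I_m -> V) (g : 'I_n -> V) :
  codom (glue us g) =i [predU codom us & codom g].
Proof.
move=> u; rewrite inE /=; apply/codomP/orP => [[i ->]|[]/codomP[j ->]].
- by rewrite /glue; case: split => j; [left | right]; apply: codom_f.
- by exists (unsplit (inl j)); rewrite /glue unsplitK.
- by exists (unsplit (inr j)); rewrite /glue unsplitK.
Qed.

(** Block Gaussian elimination: a unipotent upper factor clears [Y] and leaves a block lower
    triangular matrix. *)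
Lemma det_block_schur m n (X : 'M[R]_m) (Y : 'M_(m, n)) (Z : 'M_(n, m))
    (A : 'M_n) : A \in unitmx ->
  \det (block_mx X Y Z A) = \det A * \det (X - Y *m invmx A *m Z).
Proof.
move=> Au; have -> : block_mx X Y Z A =
    block_mx 1%:M (Y *m invmx A) 0 1%:M *m block_mx (X - Y *m invmx A *m Z) 0 Z A.
  by rewrite mulmx_block !mul1mx !mul0mx !add0r mulmxKV // subrK.
by rewrite det_mulmx det_ublock det_lblock !det1 !mul1r mulrC.
Qed.

(** The response matrix left after eliminating the vertices of [g], given entrywise at arbitrary
    vertices, so that the terminals can be chosen afterwards. *)
Definition schur L n (g : 'I_n -> V) u v : R :=
  L u v - \sum_j (\sum_i L u (g i) * invmx (kermat L g g) i j) * L (g j) v.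

Lemma kermat_schur L m m' n (g : 'I_n -> V) (us : 'I_m -> V) (ws : 'I_m' -> V) :
  kermat (schur L g) us ws
  = kermat L us ws - kermat L us g *m invmx (kermat L g g) *m kermat L g ws.
Proof.
apply/matrixP => i j; rewrite !mxE; congr (_ - _); apply: eq_bigr => k _.
by rewrite !mxE; congr (_ * _); apply: eq_bigr => l _; rewrite !mxE.
Qed.

Lemma det_kermat_glue L m n (us : 'I_m -> V) (g : 'I_n -> V) :
    kermat L g g \in unitmx ->
  \det (kermat L (glue us g) (glue us g))
  = \det (kermat L g g) * \det (kermat (schur L g) us us).
Proof. by move=> Au; rewrite kermat_glue det_block_schur // kermat_schur. Qed.

Lemma eq_schur L L' (D : {pred V}) n (g : 'I_n -> V) :
    {in D &, L =2 L'} -> (forall i, g i \in D) ->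
  {in D &, schur L g =2 schur L' g}.
Proof.
move=> eqL Dg u v Du Dv; rewrite /schur eqL //; congr (_ - _).
have -> : kermat L g g = kermat L' g g by apply/matrixP => i j; rewrite !mxE eqL.
apply: eq_bigr => j _; rewrite eqL //; congr (_ * _).
by apply: eq_bigr => i _; rewrite eqL.
Qed.

(** The inverse of the symmetric eliminated block is symmetric; exchanging the two sums then swaps
    [u] and [v]. *)
Lemma schur_sym L n (g : 'I_n -> V) u v : (forall a b, L a b = L b a) ->
  schur L g u v = schur L g v u.
Proof.
move=> L_sym; have invT : (invmx (kermat L g g))^T = invmx (kermat L g g).
  by rewrite trmx_inv; congr invmx; apply/matrixP => i j; rewrite !mxE.
rewrite /schur L_sym; congr (_ - _).
under eq_bigr do rewrite mulr_suml.
rewrite exchange_big; apply: eq_bigr => i _ /=; rewrite mulr_suml.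
apply: eq_bigr => j _; rewrite (L_sym u) (L_sym _ v) mulrC.
by rewrite [L _ u * _]mulrC mulrA -[in RHS]invT mxE.
Qed.

Lemma kermatD L1 L2 L m n (g : 'I_m -> V) (h : 'I_n -> V) :
    (forall u v, L u v = L1 u v + L2 u v) ->
  kermat L g h = kermat L1 g h + kermat L2 g h.
Proof. by move=> LD; apply/matrixP => i j; rewrite !mxE LD. Qed.

Lemma kermat_eq0 L m n (g : 'I_m -> V) (h : 'I_n -> V) :
  (forall i j, L (g i) (h j) = 0) -> kermat L g h = 0.
Proof. by move=> L0; apply/matrixP => i j; rewrite !mxE. Qed.

(** * Elimination in a sum of two kernels *)

Section Union.
Variables (L1 L2 L : V -> V -> R) (n1 n2 : nat) (g1 : 'I_n1 -> V) (g2 : 'I_n2 -> V).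
Hypothesis LD : forall u v, L u v = L1 u v + L2 u v.
Hypothesis L1g2l : forall i u, L1 (g2 i) u = 0.
Hypothesis L1g2r : forall i u, L1 u (g2 i) = 0.
Hypothesis L2g1l : forall i u, L2 (g1 i) u = 0.
Hypothesis L2g1r : forall i u, L2 u (g1 i) = 0.

Lemma kermat_union :
  kermat L (glue g1 g2) (glue g1 g2)
  = block_mx (kermat L1 g1 g1) 0 0 (kermat L2 g2 g2).
Proof.
rewrite kermat_glue !(kermatD _ _ LD).
rewrite (@kermat_eq0 L2 _ _ g1 g1) // (@kermat_eq0 L1 _ _ g1 g2) //.
rewrite (@kermat_eq0 L1 _ _ g2 g1) // (@kermat_eq0 L1 _ _ g2 g2) //.
by rewrite (@kermat_eq0 L2 _ _ g1 g2) // (@kermat_eq0 L2 _ _ g2 g1) // !addr0 add0r.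
Qed.

(** The eliminated block is block diagonal, hence so is its inverse, and each [L_i] vanishes at the
    inner vertices of the other side: no mixed term survives. *)
Lemma schur_union u v :
    kermat L1 g1 g1 \in unitmx -> kermat L2 g2 g2 \in unitmx ->
  schur L (glue g1 g2) u v = schur L1 g1 u v + schur L2 g2 u v.
Proof.
move=> A1u A2u.
have [B1 B1E] : {B1 | B1 = invmx (kermat L1 g1 g1)} by eexists.
have [B2 B2E] : {B2 | B2 = invmx (kermat L2 g2 g2)} by eexists.
have invE : invmx (kermat L (glue g1 g2) (glue g1 g2)) = block_mx B1 0 0 B2.
  have AB : kermat L (glue g1 g2) (glue g1 g2) *m block_mx B1 0 0 B2 = 1%:M.
    rewrite kermat_union mulmx_block !mulmx0 !mul0mx !addr0 !add0r B1E B2E.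
    by rewrite !mulmxV // -scalar_mx_block.
  have [Au _] := mulmx1_unit AB.
  by rewrite -[LHS]mulmx1 -AB mulKmx.
have glue_l i : glue g1 g2 (lshift n2 i) = g1 i.
  by rewrite /glue -[lshift n2 i]/(unsplit (inl i)) unsplitK.
have glue_r i : glue g1 g2 (rshift n1 i) = g2 i.
  by rewrite /glue -[rshift n1 i]/(unsplit (inr i)) unsplitK.
rewrite /schur LD invE big_split_ord /= opprD addrACA; congr (_ - _ + (_ - _)).
  apply: eq_bigr => j _; rewrite glue_l LD L2g1l addr0 big_split_ord /=.
  rewrite [X in _ + X]big1 => [|i _]; last by rewrite block_mxEdl mxE mulr0.
  rewrite addr0 -B1E; congr (_ * _); apply: eq_bigr => i _.
  by rewrite glue_l LD L2g1r addr0 block_mxEul.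
apply: eq_bigr => j _; rewrite glue_r LD L1g2l add0r big_split_ord /=.
rewrite [X in X + _]big1 => [|i _]; last by rewrite block_mxEur mxE mulr0.
rewrite add0r -B2E; congr (_ * _); apply: eq_bigr => i _.
by rewrite glue_r LD L1g2r add0r block_mxEdr.
Qed.
End Union.

Lemma det_mx2 (A : 'M[R]_2) :
  \det A = A 0 0 * A 1 1 - A 0 1 * A 1 0.
Proof.
rewrite (expand_det_row _ 0) !big_ord_recl big_ord0 /cofactor !det_mx11 !mxE /=.
rewrite addr0 expr0 expr1 !mul1r mulN1r mulrN.
by congr (_ * A _ _ - A _ _ * A _ _); apply: val_inj.
Qed.
End Schur.

(** * Three terminals *)

Section ThreeTerminals.
Variables (R : fieldType) (V E : finType) (src tgt : E -> V).
Variables (VS : {set V}) (ES : {set E}) (p q s : V) (n : nat) (g : 'I_n -> V).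
Hypothesis wf : wf_graph src tgt VS ES.
Hypothesis sVS : [set p; q; s] \subset VS.
Hypothesis pq : p != q.
Hypothesis qs : q != s.
Hypothesis ps : p != s.
Hypothesis g_inj : injective g.
Hypothesis g_im : codom g =i VS :\: [set p; q; s].
Hypothesis inner_unit : kermat (lap R src tgt ES) g g \in unitmx.

Let L := lap R src tgt ES.
Let T := \det (kermat L g g).
Let S := schur L g.

Let Vp : p \in VS. Proof. by apply: (subsetP sVS); rewrite !inE eqxx. Qed.
Let Vq : q \in VS. Proof. by apply: (subsetP sVS); rewrite !inE eqxx orbT. Qed.
Let Vs : s \in VS. Proof. by apply: (subsetP sVS); rewrite !inE eqxx orbT. Qed.

Let g_notin i : g i \notin [set p; q; s].
Proof. by have := codom_f g i; rewrite g_im inE => /andP[]. Qed.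
Let gNq i : g i != q.
Proof. by have := g_notin i; rewrite !inE !negb_or => /andP[/andP[]]. Qed.
Let gNs i : g i != s.
Proof. by have := g_notin i; rewrite !inE !negb_or => /andP[]. Qed.

Let wf_map (f : V -> V) : wf_graph (f \o src) (f \o tgt) (f @: VS) ES.
Proof.
by apply/forall_inP => e /(forall_inP wf)/andP[? ?]; rewrite /= !imset_f.
Qed.

Let us (i : 'I_2) : V := if i == 0 then q else s.
Let c (u : V) (i : 'I_1) : V := u.

Let c_inj u : injective (c u).
Proof. by move=> i j _; rewrite !ord1. Qed.

Let codom_c u : codom (c u) =i pred1 u.
Proof. by move=> v; apply/codomP/eqP => [[]//|->]; exists 0. Qed.

(** Matrix-tree at the root [p], then elimination of the inner vertices, leaves the 2 by 2 response
    on [q] and [s]. *)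
Lemma ntrees_schur :
  (ntrees src tgt VS ES)%:R = T * (S q q * S s s - S q s ^+ 2).
Proof.
rewrite -(matrix_tree R (g := glue us g) wf Vp).
- rewrite det_kermat_glue // det_mx2 !mxE /= -/S.
  by rewrite [S s q]schur_sym //; exact: lap_sym.
- apply: glue_inj => // [i j|i j]; last by rewrite /us eq_sym; case: ifP.
  have ord2 (k : 'I_2) : k = 0 \/ k = 1.
    by case: k => [[|[|//]] k2]; [left | right]; apply: val_inj.
  case: (ord2 i) => ->; case: (ord2 j) => -> //= /eqP.
    by rewrite (negPf qs).
  by rewrite eq_sym (negPf qs).
move=> u; rewrite codom_glue !inE /= g_im !inE.
have -> : (u \in codom us) = (u == q) || (u == s).
  apply/codomP/orP => [[i ->]|[/eqP->|/eqP->]]; [|by exists 0|by exists 1].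
  by rewrite /us; case: ifP; [left | right].
case: (eqVneq u q) => [->|_]; first by rewrite (eq_sym q p) pq Vq.
case: (eqVneq u s) => [->|_]; first by rewrite (eq_sym s p) ps Vs.
by rewrite !orbF.
Qed.

(** Rooted at the merged vertex [p], the quotient has exactly the inner vertices left, with their
    Laplacian unchanged. *)
Lemma ntrees_ident3_schur : (ntrees_quot src tgt (ident3 p q s) VS ES)%:R = T.
Proof.
have f3 : ident3 p q s @: VS = VS :\ q :\ s.
  apply/setP => u; rewrite !inE; apply/imsetP/and3P => [[v Vv ->]|[uNs uNq Vu]].
    rewrite /ident3; case: (eqVneq v q) => [_|]; first by rewrite /= pq ps Vp.
    by case: (eqVneq v s) => [_|] //= *; rewrite ?pq ?ps ?Vp.
  by exists u; rewrite // /ident3 (negPf uNs) (negPf uNq).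
rewrite /ntrees_quot -(matrix_tree R (g := g) (r := p)) //.
- congr (\det _); apply/matrixP => i j; rewrite !mxE.
  by rewrite lap_ident3.
- by rewrite f3 !inE pq ps Vp.
- by move=> u; rewrite g_im f3 !inE !negb_or; do !case: eqP.
Qed.

(** Common form of the three pair identifications: [y] is merged into [x], the root is [p], and [z]
    is the one terminal left besides it. [M] stands for [L] when [x] is [p], and for the quotient
    Laplacian when [q] and [s] merge, with [x] and [z] both [q]. *)
Let ntrees_ident2_schur (x y z : V) (M : V -> V -> R) :
  let f := ident2 x y in
    x != y -> x \in VS -> z != p -> p != y -> z != y -> z \in VS ->
    [set p; q; s] = [set p; y; z] ->
    {in z :: codom g &,
      lap R (f \o src) (f \o tgt) ES =2 M} ->
    (forall i j, M (g i) (g j) = L (g i) (g j)) ->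
  (ntrees_quot src tgt f VS ES)%:R = T * schur M g z z.
Proof.
move=> f xy Vx zp py zy Vz pqsE eqM MgE.
have gM : kermat M g g = kermat L g g.
  by apply/matrixP => i j; rewrite !mxE.
have gNz i : z != g i.
  by apply: contraNneq (g_notin i) => <-; rewrite pqsE !inE eqxx orbT.
rewrite /ntrees_quot -/f -(matrix_tree R (g := glue (c z) g) (r := p)) //.
- have -> : kermat (lap R (f \o src) (f \o tgt) ES) (glue (c z) g) (glue (c z) g)
      = kermat M (glue (c z) g) (glue (c z) g).
    have glueP i : glue (c z) g i \in z :: codom g.
      have := codom_f (glue (c z) g) i; rewrite codom_glue !inE.
      by rewrite codom_c.
    by apply/matrixP => i j; rewrite !mxE eqM.
  by rewrite det_kermat_glue gM // det_mx11 mxE.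
- by rewrite imset_ident2 // !inE py Vp.
- by apply: glue_inj.
move=> u; rewrite codom_glue !inE codom_c g_im imset_ident2 // pqsE !inE.
case: (eqVneq u z) => [->|_] /=; first by rewrite zp zy Vz.
by rewrite orbF negb_or; case: (u == p); case: (u == y).
Qed.

Let g_neq (u v : V) : u \in v :: codom g -> forall w, w != v ->
  w \in [set p; q; s] -> u != w.
Proof.
rewrite inE => /orP[/eqP->|/codomP[i ->]] w wNv w3; first by rewrite eq_sym.
by apply: contraNneq (g_notin i) => ->.
Qed.

Lemma ntrees_ps_schur : (ntrees_quot src tgt (ident2 p s) VS ES)%:R = T * S q q.
Proof.
apply: ntrees_ident2_schur => //; first by rewrite eq_sym.
  by apply/setP => u; rewrite !inE orbAC.
by move=> u v uq vq; apply: lap_ident2;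
  [apply: (g_neq uq) | apply: (g_neq uq) | apply: (g_neq vq) | apply: (g_neq vq)];
  rewrite ?inE ?eqxx ?orbT // eq_sym.
Qed.

Lemma ntrees_pq_schur : (ntrees_quot src tgt (ident2 p q) VS ES)%:R = T * S s s.
Proof.
apply: ntrees_ident2_schur => //; rewrite 1?eq_sym //.
by move=> u v uq vq; apply: lap_ident2;
  [apply: (g_neq uq) | apply: (g_neq uq) | apply: (g_neq vq) | apply: (g_neq vq)];
  rewrite ?inE ?eqxx ?orbT.
Qed.

(** The quotient Laplacian adds the rows and columns of [q] and [s] and leaves the inner block
    alone. By bilinearity the response at the merged vertex is the sum of the four entries of [S] on
    [q] and [s]. *)
Lemma ntrees_qs_schur : (ntrees_quot src tgt (ident2 q s) VS ES)%:R
  = T * (S q q + S q s *+ 2 + S s s).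
Proof.
pose f := ident2 q s; pose M := lap R (f \o src) (f \o tgt) ES.
have Mgg i j : M (g i) (g j) = L (g i) (g j) by apply: lap_ident2.
rewrite (@ntrees_ident2_schur _ _ q M) //; first last.
- by apply/setP => u; rewrite !inE orbAC.
- by rewrite eq_sym.
congr (_ * _); rewrite mulr2n {2}/S [in X in _ + X + _]schur_sym; last exact: lap_sym.
have Mqg i : M q (g i) = L q (g i) + L s (g i) by apply: lap_ident2l.
have Mgq i : M (g i) q = L (g i) q + L (g i) s.
  by rewrite [M _ _]lap_sym -/(M _ _) Mqg; congr (_ + _); apply: lap_sym.
have gM : kermat M g g = kermat L g g by apply/matrixP => i j; rewrite !mxE.
rewrite /S /schur gM [M q q]lap_ident2ll // -/L.
set B := invmx _.
have -> : \sum_j (\sum_i M q (g i) * B i j) * M (g j) q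
  = \sum_j (\sum_i L q (g i) * B i j) * L (g j) q
  + \sum_j (\sum_i L s (g i) * B i j) * L (g j) q
  + \sum_j (\sum_i L q (g i) * B i j) * L (g j) s
  + \sum_j (\sum_i L s (g i) * B i j) * L (g j) s.
  rewrite -!big_split; apply: eq_bigr => j _ /=; rewrite Mgq.
  under eq_bigr do rewrite Mqg mulrDl.
  by rewrite big_split /=; ring.
by rewrite [L s q]lap_sym -/L; ring.
Qed.
End ThreeTerminals.

(** * Gluing two graphs along p, q, s *)

(** This is [ntrees_schur] for the union, whose inner vertices are those of both sides: the inner
    determinant factors and the responses add. *)
Lemma ntrees_union_schur (R : fieldType) (V E : finType) (src tgt : E -> V)
    (V1 V2 : {set V}) (E1 E2 : {set E}) (p q s : V) n1 n2
    (g1 : 'I_n1 -> V) (g2 : 'I_n2 -> V) :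
    V1 :&: V2 = [set p; q; s] -> [disjoint E1 & E2] ->
    p != q -> q != s -> p != s ->
    wf_graph src tgt V1 E1 -> wf_graph src tgt V2 E2 ->
    injective g1 -> codom g1 =i V1 :\: [set p; q; s] ->
    injective g2 -> codom g2 =i V2 :\: [set p; q; s] ->
  let L1 := lap R src tgt E1 in
  let L2 := lap R src tgt E2 in
    kermat L1 g1 g1 \in unitmx -> kermat L2 g2 g2 \in unitmx ->
  let S u v := schur L1 g1 u v + schur L2 g2 u v in
  (ntrees src tgt (V1 :|: V2) (E1 :|: E2))%:R
  = \det (kermat L1 g1 g1) * \det (kermat L2 g2 g2)
    * (S q q * S s s - S q s ^+ 2).
Proof.
move=> VI dis pq qs ps wf1 wf2 g1_inj g1_im g2_inj g2_im L1 L2 u1 u2 S.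
pose L := lap R src tgt (E1 :|: E2).
have LD u v : L u v = L1 u v + L2 u v by apply: lapU.
have g1NV2 i : g1 i \notin V2.
  have := codom_f g1 i; rewrite g1_im -VI !inE.
  by case: (g1 i \in V1) => //=; rewrite andbT.
have g2NV1 i : g2 i \notin V1.
  have := codom_f g2 i; rewrite g2_im -VI !inE.
  by case: (g2 i \in V2); rewrite ?andbT ?andbF.
have L1g2l i u : L1 (g2 i) u = 0 by apply: lap0l wf1 _.
have L2g1l i u : L2 (g1 i) u = 0 by apply: lap0l wf2 _.
have L1g2r i u : L1 u (g2 i) = 0 by rewrite /L1 lap_sym; apply: L1g2l.
have L2g1r i u : L2 u (g1 i) = 0 by rewrite /L2 lap_sym; apply: L2g1l.
have kU := kermat_union LD L1g2l L1g2r L2g1l L2g1r.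
have SU u v := schur_union LD L1g2l L1g2r L2g1l L2g1r u v u1 u2.
rewrite (@ntrees_schur R _ _ _ _ _ _ p q s _ (glue g1 g2)) //.
- by rewrite -/L !SU kU det_ublock.
- apply/forall_inP => e; rewrite !inE => /orP[/(forall_inP wf1)|/(forall_inP wf2)].
    by case/andP => -> ->.
  by case/andP => -> ->; rewrite !orbT.
- by rewrite -VI subIset // subsetUl.
- apply: glue_inj => // i j.
  have := codom_f g1 i; rewrite g1_im inE => /andP[_ V1g].
  by apply: contraTneq V1g => ->.
- move=> u; rewrite codom_glue !inE g1_im g2_im !inE.
  by rewrite -andb_orr.
by rewrite -/L kU unitmxE det_ublock unitrM -!unitmxE u1.
Qed.

(* G = (setT, setT) on ambient types V, E; G_i = (Vi, Ei). *)
Theorem theorem5p4 (V E : finType) (src tgt : E -> V)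
  (V1 V2 : {set V}) (E1 E2 : {set E}) (p q s : V) :
  V1 :|: V2 = [set: V] ->
  E1 :|: E2 = [set: E] ->
  [disjoint E1 & E2] ->
  V1 :&: V2 = [set p; q; s] ->
  p != q -> q != s -> p != s ->
  wf_graph src tgt V1 E1 ->
  wf_graph src tgt V2 E2 ->
  connected_graph src tgt [set: V] [set: E] ->
  connected_graph src tgt V1 E1 ->
  connected_graph src tgt V2 E2 ->
  let t1 := ntrees src tgt V1 E1 in
  let t2 := ntrees src tgt V2 E2 in
  let t1pqs := ntrees_quot src tgt (ident3 p q s) V1 E1 in
  let t2pqs := ntrees_quot src tgt (ident3 p q s) V2 E2 in
  let a1 := ntrees_quot src tgt (ident2 p s) V1 E1 in
  let b1 := ntrees_quot src tgt (ident2 p q) V1 E1 in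
  let c1 := ntrees_quot src tgt (ident2 q s) V1 E1 in
  let a2 := ntrees_quot src tgt (ident2 p s) V2 E2 in
  let b2 := ntrees_quot src tgt (ident2 p q) V2 E2 in
  let c2 := ntrees_quot src tgt (ident2 q s) V2 E2 in
  ((ntrees src tgt [set: V] [set: E])%:R : rat) =
     (t1 * t2pqs)%:R + (t2 * t1pqs)%:R
     + 2^-1 * (a1%:R * (- a2%:R + b2%:R + c2%:R)
              + b1%:R * (a2%:R - b2%:R + c2%:R)
              + c1%:R * (a2%:R + b2%:R - c2%:R))
  /\
  (* In particular: if G2 is a copy of G1 glued along p, q, s *)
  (forall (phi : V -> V) (psi : E -> E),
     {in V1 &, injective phi} -> phi @: V1 = V2 ->
     phi p = p -> phi q = q -> phi s = s ->
     {in E1 &, injective psi} -> psi @: E1 = E2 ->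
     {in E1, forall e,
        ((src (psi e), tgt (psi e)) = (phi (src e), phi (tgt e))) \/
        ((src (psi e), tgt (psi e)) = (phi (tgt e), phi (src e)))} ->
     ntrees src tgt [set: V] [set: E] = 4 * t1 * t1pqs)%N.
Proof.
move=> VU EU dis VI pq qs ps wf1 wf2 _ conn1 conn2 t1 t2 t1pqs t2pqs.
move=> a1 b1 c1 a2 b2 c2.
have sub1 : [set p; q; s] \subset V1 by rewrite -VI subsetIl.
have sub2 : [set p; q; s] \subset V2 by rewrite -VI subsetIr.
have p3 : p \in [set p; q; s] by rewrite !inE eqxx.
have q3 : q \in [set p; q; s] by rewrite !inE eqxx orbT.
have s3 : s \in [set p; q; s] by rewrite !inE eqxx orbT.
have inner_unit (VS : {set V}) (ES : {set E}) n (g : 'I_n -> V) :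
    connected_graph src tgt VS ES -> [set p; q; s] \subset VS -> injective g ->
    codom g =i VS :\: [set p; q; s] ->
  kermat (lap rat src tgt ES) g g \in unitmx.
  move=> conn sub g_inj g_im; apply: (@lap_unitmx rat _ _ _ _ VS ES p) => //.
    exact: (subsetP sub).
  apply/subsetP => u; rewrite g_im !inE !negb_or -!andbA.
  by case/and4P=> -> _ _ ->.
have enumP (A : {set V}) : codom (enum_val : 'I_#|A| -> V) =i A.
  move=> u; apply/codomP/idP => [[i ->]|Au]; first exact: enum_valP.
  by exists (enum_rank_in Au u); rewrite enum_rankK_in.
pose g1 : 'I_#|V1 :\: [set p; q; s]| -> V := enum_val.
have g1_inj : injective g1 := enum_val_inj.
have g1_im : codom g1 =i V1 :\: [set p; q; s] := enumP _.
have u1 := inner_unit _ _ _ _ conn1 sub1 g1_inj g1_im.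
rewrite -VU -EU; split.
  pose g2 : 'I_#|V2 :\: [set p; q; s]| -> V := enum_val.
  have g2_inj : injective g2 := enum_val_inj.
  have g2_im : codom g2 =i V2 :\: [set p; q; s] := enumP _.
  have u2 := inner_unit _ _ _ _ conn2 sub2 g2_inj g2_im.
  rewrite (ntrees_union_schur VI dis _ _ _ wf1 wf2 g1_inj g1_im g2_inj g2_im) //.
  rewrite !natrM /t1 /t2 /t1pqs /t2pqs /a1 /b1 /c1 /a2 /b2 /c2.
  rewrite (ntrees_schur wf1 sub1 pq qs ps g1_inj g1_im u1).
  rewrite (ntrees_schur wf2 sub2 pq qs ps g2_inj g2_im u2).
  rewrite (ntrees_ident3_schur rat wf1 sub1 pq ps g1_inj g1_im).
  rewrite (ntrees_ident3_schur rat wf2 sub2 pq ps g2_inj g2_im).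
  rewrite (ntrees_ps_schur wf1 sub1 pq qs ps g1_inj g1_im u1).
  rewrite (ntrees_ps_schur wf2 sub2 pq qs ps g2_inj g2_im u2).
  rewrite (ntrees_pq_schur wf1 sub1 pq qs ps g1_inj g1_im u1).
  rewrite (ntrees_pq_schur wf2 sub2 pq qs ps g2_inj g2_im u2).
  rewrite (ntrees_qs_schur wf1 sub1 pq qs ps g1_inj g1_im u1).
  rewrite (ntrees_qs_schur wf2 sub2 pq qs ps g2_inj g2_im u2).
  (* With [x_i], [y_i], [z_i] the entries of [S_i] at [(q,q)], [(q,s)], [(s,s)], half the bracket is
     [T_1 T_2 (x_1 z_2 + z_1 x_2 - 2 y_1 y_2)], the mixed part of the determinant of [S_1 + S_2]. *)
  by field.
move=> phi psi phi_inj phiV phip phiq phis psi_inj psiE endsE.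
have V1g i : g1 i \in V1 by have := codom_f g1 i; rewrite g1_im inE => /andP[].
(* Listing the inner vertices of the copy through [phi] makes the two inner blocks equal entry by
   entry. *)
pose g2 := phi \o g1.
have g2_inj : injective g2.
  by move=> i j /phi_inj eqij; apply/g1_inj/eqij.
have phi3 u : u \in V1 -> (phi u \in [set p; q; s]) = (u \in [set p; q; s]).
  move=> V1u; rewrite !inE -{1}phip -{1}phiq -{1}phis.
  by rewrite !(inj_in_eq phi_inj) // (subsetP sub1).
have g2_im : codom g2 =i V2 :\: [set p; q; s].
  move=> u; rewrite inE -phiV; apply/codomP/andP => [[i ->]|[u3 /imsetP[v V1v uE]]].
    rewrite /g2 /= imset_f // phi3 //.
    by have := codom_f g1 i; rewrite g1_im inE => /andP[].
  have /codomP[i vE] : v \in codom g1 by rewrite g1_im inE V1v -phi3 // -uE u3.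
  by exists i; rewrite uE vE.
have u2 := inner_unit _ _ _ _ conn2 sub2 g2_inj g2_im.
pose L1 := lap rat src tgt E1; pose L2 := lap rat src tgt E2.
(* An edge reversed by the copy changes the sign of both factors of its term. *)
have L2phi : {in V1 &, (fun u v => L2 (phi u) (phi v)) =2 L1}.
  move=> u v V1u V1v; rewrite /L2 -psiE /lap big_imset //=.
  apply: eq_bigr => e E1e; have /andP[V1s V1t] := forall_inP wf1 e E1e.
  have := endsE e E1e; case=> -[-> ->]; rewrite !(inj_in_eq phi_inj) //.
  ring.
have S2 u v : u \in V1 -> v \in V1 ->
    schur L2 g2 (phi u) (phi v) = schur L1 g1 u v.
  (* Eliminating [phi \o g1] from [L2] is, by unfolding, eliminating [g1] from [L2] pulled back
     along [phi]. *)
  by move=> V1u V1v; apply: (eq_schur L2phi V1g).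
have [V1q V1s] := (subsetP sub1 q q3, subsetP sub1 s s3).
apply/eqP; rewrite -(eqr_nat rat) !natrM; apply/eqP.
rewrite (ntrees_union_schur VI dis _ _ _ wf1 wf2 g1_inj g1_im g2_inj g2_im) //.
rewrite /t1 /t1pqs.
rewrite (ntrees_schur wf1 sub1 pq qs ps g1_inj g1_im u1).
rewrite (ntrees_ident3_schur rat wf1 sub1 pq ps g1_inj g1_im).
rewrite -/L1 -/L2.
have -> : kermat L2 g2 g2 = kermat L1 g1 g1.
  by apply/matrixP => i j; rewrite !mxE /= L2phi.
have := (S2 q q V1q V1q, S2 s s V1s V1s, S2 q s V1q V1s).
rewrite !phiq !phis => -[[-> ->] ->]; ring.
Qed.
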